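(* Let $\Sigma$ be a finite alphabet and let $L\subseteq\Sigma^*$ be a regular language. Then there exist $n\geq 1$, a set $R\subseteq\{(x,y):1\leq x,y\leq n+1,\ x\neq y\}$, and $\alpha_1,\dots,\alpha_n\in\{\{\mathtt a\}:\mathtt a\in\Sigma\}\cup\{\emptyset\}$ such that $$L=a_R^{(n)}(\alpha_1,\dots,\alpha_n).$$
   Context: For a set $R\subseteq\{(x,y):1\leq x,y\leq n+1,\ x\neq y\}$ (an antireflexive relation on $\{1,\dots,n+1\}$; the symbol $a_R^{(n)}$ denotes the corresponding $n$-ary operator), let $\mathbf G_R^{(n)}$ be the grammar with terminal alphabet $\{\mathtt a_1,\dots,\mathtt a_n\}$ ($n$ distinct symbols), nonterminals $\mathtt S_1,\dots,\mathtt S_{n+1}$, axiom $\mathtt S_1$, and productions: $\mathtt S_i\to \mathtt a_i\mathtt S_{i+1}$ for $1\leq i\leq n$; $\mathtt S_i\to\mathtt S_{i'}$ for each $(i,i')\in R$; $\mathtt S_{n+1}\to\varepsilon$. Let $\mathbb L(\mathbf G_R^{(n)})\subseteq\{\mathtt a_1,\dots,\mathtt a_n\}^*$ be the language it generates. For languages $L_1,\dots,L_n\subseteq\Sigma^*$, $a_R^{(n)}(L_1,\dots,L_n)$ is the language obtained from $\mathbb L(\mathbf G_R^{(n)})$ by replacing each letter $\mathtt a_i$ by $L_i$, i.e. the union of the concatenations $L_{k_1}L_{k_2}\cdots L_{k_p}$ over all words $\mathtt a_{k_1}\cdots\mathtt a_{k_p}\in\mathbb L(\mathbf G_R^{(n)})$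 (the empty word contributing $\{\varepsilon\}$; a concatenation with some factor $\emptyset$ is $\emptyset$). *)

(* Defs.v *)
(* Languages are classical sets of words: Leibniz equality of languages is
   extensional, and membership need not be decidable. *)
From Stdlib Require Import Relation_Operators.
From mathcomp Require Import all_boot.
From mathcomp Require Import boolp classical_sets.
Set Implicit Arguments.
Unset Strict Implicit.
Unset Printing Implicit Defensive.

Local Open Scope classical_set_scope.

Notation language Sigma := (set (seq Sigma)).

Definition lang_eps {Sigma : Type} : language Sigma := [set [::]].

Definition lang_cat {Sigma : Type} (A B : language Sigma) : language Sigma :=
  [set u ++ v | u in A & v in B].

Definition lang_star {Sigma : Type} (A : language Sigma) : language Sigma :=
  \bigcup_k iter k (lang_cat A) lang_eps.

Inductive regular {Sigma : Type} : language Sigma -> Prop :=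
| regular_empty : regular set0
| regular_eps : regular lang_eps
| regular_letter (a : Sigma) : regular [set [:: a]]
| regular_union A B : regular A -> regular B -> regular (A `|` B)
| regular_cat A B : regular A -> regular B -> regular (lang_cat A B)
| regular_star A : regular A -> regular (lang_star A).

(* In a sentential form, [inl] marks a nonterminal and [inr] a terminal. *)
Record grammar (T N : Type) := Grammar {
  axiom_of : N;
  production : N -> seq (N + T) -> Prop
}.

Inductive derive1 {T N : Type} (G : grammar T N) :
    seq (N + T) -> seq (N + T) -> Prop :=
| Derive1 u A s v : production G A s ->
    derive1 G (u ++ inl A :: v) (u ++ s ++ v).

Definition generated {T N : Type} (G : grammar T N) : language T :=
  [set w | clos_refl_trans _ (derive1 G) [:: inl (axiom_of G)]
             [seq inr a | a <- w]].

(* All indices are shifted down by one: the ordinal i : 'I_n stands for the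
   letter a_(i+1), and i : 'I_n.+1 for the nonterminal S_(i+1). *)
Inductive GR_production (n : nat) (R : set ('I_n.+1 * 'I_n.+1)) :
    'I_n.+1 -> seq ('I_n.+1 + 'I_n) -> Prop :=
| GR_letter (i : 'I_n) :
    GR_production R (widen_ord (leqnSn n) i) [:: inr i; inl (lift ord0 i)]
| GR_jump (i j : 'I_n.+1) : R (i, j) -> GR_production R i [:: inl j]
| GR_end : GR_production R ord_max [::].

Definition GR (n : nat) (R : set ('I_n.+1 * 'I_n.+1)) : grammar 'I_n 'I_n.+1 :=
  Grammar ord0 (GR_production R).

Definition aR (n : nat) (R : set ('I_n.+1 * 'I_n.+1)) {Sigma : Type}
    (L : 'I_n -> language Sigma) : language Sigma :=
  \bigcup_(k in generated (GR R)) foldr lang_cat lang_eps [seq L i | i <- k].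

(* Main.v *)
(** Partial derivatives (Antimirov): a regular language is a member of a finite
    family [F] in which [a :: w \in F i] always has a witness [j] with
    [w \in F j] and [a F_j `<=` F_i].  Put on a line the language [L], then the
    pairs [a F_i, F_i] for all [(i, a)], then [{eps}]; the step inside a pair
    carries the letter [a], every other step carries [set0], and a jump from
    [p] to [q] is allowed exactly when the language at [q] is included in the
    language at [p].  No derivation can leave the language attached to its
    first position, and the family property lets every word of it be read. *)
Require Import Defs.
From Stdlib Require Import Relation_Operators.
From mathcomp Require Import all_boot.
From mathcomp Require Import boolp classical_sets.
Local Open Scope classical_set_scope.

Lemma lang_catS {T : Type} (A B C D : language T) :
  A `<=` B -> C `<=` D -> lang_cat A C `<=` lang_cat B D.
Proof.
by move=> AB CD _ [u Au [v Cv <-]]; exists u; [apply: AB|exists v => //; apply: CD].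
Qed.

Lemma lang_cat1s {T : Type} (A : language T) : lang_cat lang_eps A = A.
Proof.
apply/seteqP; split=> [_ [_ -> [v Av <-]] //|v Av].
by exists [::] => //; exists v.
Qed.

Lemma lang_cats1 {T : Type} (A : language T) : lang_cat A lang_eps = A.
Proof.
apply/seteqP; split=> [_ [u Au [_ -> <-]]|u Au]; first by rewrite cats0.
by exists u => //; exists [::] => //; rewrite cats0.
Qed.

Lemma lang_catA {T : Type} (A B C : language T) :
  lang_cat A (lang_cat B C) = lang_cat (lang_cat A B) C.
Proof.
apply/seteqP; split=> [_ [u Au [_ [v Bv [w Cw <-]] <-]]|].
  by exists (u ++ v); [exists u => //; exists v|exists w; rewrite ?catA].
move=> _ [_ [u Au [v Bv <-]] [w Cw <-]].
by exists u => //; exists (v ++ w); [exists v => //; exists w|rewrite catA].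
Qed.

Lemma foldr_lang_cat {T : Type} (s t : seq (language T)) :
  foldr lang_cat lang_eps (s ++ t) =
  lang_cat (foldr lang_cat lang_eps s) (foldr lang_cat lang_eps t).
Proof. by elim: s => [|A s IHs] /=; rewrite ?lang_cat1s // IHs lang_catA. Qed.

Lemma lang_star_nil {T : Type} (A : language T) : lang_star A [::].
Proof. by exists 0. Qed.

Lemma lang_star_cat {T : Type} (A : language T) (u v : seq T) :
  A u -> lang_star A v -> lang_star A (u ++ v).
Proof. by move=> Au [k _ Akv]; exists k.+1 => //=; exists u => //; exists v. Qed.

(** Empty factors are skipped by induction on the number of factors; the first nonempty one supplies
    [a]. *)
Lemma lang_star_cons {T : Type} {A : language T} {a : T} {w : seq T} :
  lang_star A (a :: w) ->
  exists u v, [/\ A (a :: u), lang_star A v & w = u ++ v].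
Proof.
case=> k _; elim: k => [//|k IHk] /= [[|b u] Au [v Akv]] /=.
  by move=> vE; apply: IHk; rewrite -vE.
by case=> <- <-; exists u, v; split=> //; exists k.
Qed.

(** The witness [j] may depend on [w], like a transition of a nondeterministic automaton; hence [F]
    need not be closed under unions and can stay finite. *)
Definition derivation_closed {T I : Type} (F : I -> language T) :=
  forall i a w, F i (a :: w) ->
    exists2 j, F j w & forall v, F j v -> F i (a :: v).

(** Induction on regularity. The index [None] adds the union or the star itself; for a product or a
    star, each [F x] is multiplied by what remains to be read after it. *)
Lemma regular_derivation_closed {T : Type} (L : language T) : regular L ->
  exists (I : finType) (F : I -> language T) (i : I),
    F i = L /\ derivation_closed F.
Proof.
elim=> [||a|A B _ [I [F [i [<- dF]]]] _ [J [G [j [<- dG]]]]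
       |A B _ [I [F [i [<- dF]]]] _ [J [G [j [<- dG]]]]
       |A _ [I [F [i [<- dF]]]]].
- by exists unit, (fun=> set0), tt; split.
- by exists unit, (fun=> lang_eps), tt; split.
- exists bool, (fun b => if b then [set [:: a]] else lang_eps), true.
  split=> // -[] b w //= -[-> ->]; by exists false => // v ->.
- pose H (x : option (I + J)) := match x with
    | None => F i `|` G j | Some (inl x) => F x | Some (inr y) => G y end.
  exists (option (I + J)%type), H, None; split=> // -[[x|y]|] a w /=.
  + by case/dF=> k; exists (Some (inl k)).
  + by case/dG=> k; exists (Some (inr k)).
  + case=> [/dF|/dG] [k kw kF]; first by exists (Some (inl k)) => // v /kF; left.
    by exists (Some (inr k)) => // v /kF; right.
- pose H (x : I + J) := match x with
    | inl x => lang_cat (F x) (G j) | inr y => G y end.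
  exists (I + J)%type, H, (inl i); split=> // -[x|y] a w /=; last first.
    by case/dG=> k; exists (inr k).
  (* If the first factor is empty, the letter comes from [G j]; the inclusion then holds because
     [F x] contains the empty word. *)
  case=> -[|b u] Fu [v Gv] /=.
    move=> vE; move: Gv; rewrite vE => /dG[k kw kG]; exists (inr k) => //.
    by move=> z /kG Gz; exists [::] => //; exists (a :: z).
  case=> bE <-; move: Fu; rewrite bE => /dF[k ku kF].
  exists (inl k) => /=; first by exists u => //; exists v.
  by move=> _ [z /kF Fz [t Gt <-]]; exists (a :: z) => //; exists t.
- pose H (x : option I) := match x with
    | None => lang_star (F i) | Some x => lang_cat (F x) (lang_star (F i)) end.
  have dstar a w : lang_star (F i) (a :: w) -> exists2 k, H k w &
      forall v, H k v -> lang_star (F i) (a :: v).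
    case/lang_star_cons=> u [v [/dF[k ku kF] sv ->]].
    exists (Some k) => /=; first by exists u => //; exists v.
    by move=> _ [z /kF Fz [t st <-]]; exact: (lang_star_cat _ (a :: z)).
  exists (option I), H, None; split=> // -[x|] a w /=; last exact: dstar.
  case=> -[|b u] Fu [v sv] /=.
    move=> vE; move: sv; rewrite vE => /dstar[k kw kH]; exists k => //.
    by move=> z /kH sz; exists [::] => //; exists (a :: z).
  case=> bE <-; move: Fu; rewrite bE => /dF[k ku kF].
  exists (Some k) => /=; first by exists u => //; exists v.
  by move=> _ [z /kF Fz [t st <-]]; exists (a :: z) => //; exists t.
Qed.

Lemma derive_cat {T N : Type} (G : grammar T N) (u s t : seq (N + T)) :
  clos_refl_trans _ (derive1 G) s t ->
  clos_refl_trans _ (derive1 G) (u ++ s) (u ++ t).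
Proof.
elim=> [_ _ [x A r v prod]|x|x y z _ xy _ yz].
- by apply: rt_step; rewrite !(catA u); constructor.
- exact: rt_refl.
- exact: rt_trans xy yz.
Qed.

Lemma derive_production {T N : Type} (G : grammar T N) (A : N) (s : seq (N + T)) :
  production G A s -> clos_refl_trans _ (derive1 G) [:: inl A] s.
Proof. by move/(@Derive1 _ _ G [::] A s [::]); rewrite /= cats0; exact: rt_step. Qed.

Definition interp {T N U : Type} (val : N -> language U) (alpha : T -> language U)
    (s : seq (N + T)) : language U :=
  foldr lang_cat lang_eps
    [seq match x with inl p => val p | inr i => alpha i end | x <- s].

(** Concatenation is monotone, so a rewriting step that shrinks one symbol's language shrinks that
    of the whole sentential form. *)
Lemma interp_derive {T N U : Type} (G : grammar T N)
    (val : N -> language U) (alpha : T -> language U) :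
  (forall A s, production G A s -> interp val alpha s `<=` val A) ->
  forall s t, clos_refl_trans _ (derive1 G) s t ->
    interp val alpha t `<=` interp val alpha s.
Proof.
move=> prodP s t; elim=> [_ _ [u A r v /prodP rA]|x|x y z _ yx _ zy].
- rewrite /interp !map_cat /= !foldr_lang_cat /=.
  by apply: lang_catS => //; apply: lang_catS.
- exact: subset_refl.
- exact: subset_trans zy yx.
Qed.

Definition inclusion_jumps {Sigma : Type} {n : nat} (val : 'I_n.+1 -> language Sigma) :
    set ('I_n.+1 * 'I_n.+1) :=
  [set p | p.1 <> p.2 /\ val p.2 `<=` val p.1].

(** Every production respects [val], so [interp_derive] gives one inclusion. The other is by
    induction on the word: jump to the position given by the third hypothesis, read a letter, and at
    the end jump to [ord_max]. *)
Lemma aR_inclusion_jumps {Sigma : Type} (n : nat)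
    (val : 'I_n.+1 -> language Sigma) (alpha : 'I_n -> language Sigma) :
  (forall i : 'I_n, lang_cat (alpha i) (val (lift ord0 i)) `<=`
     val (widen_ord (leqnSn n) i)) ->
  val ord_max = lang_eps ->
  (forall p a v, val p (a :: v) -> exists i : 'I_n,
     [/\ alpha i [:: a], val (widen_ord (leqnSn n) i) `<=` val p
       & val (lift ord0 i) v]) ->
  aR (inclusion_jumps val) alpha = val ord0.
Proof.
set R := inclusion_jumps val => step_sub val_max read.
have jump p q : val q `<=` val p ->
    clos_refl_trans _ (derive1 (GR R)) [:: inl p] [:: inl q].
  (* Jumps are antireflexive, so [p = q] is served by the empty derivation. *)
  have [->|/eqP pq] := eqVneq p q; first by move=> _; exact: rt_refl.
  by move=> qp; apply: derive_production; apply: GR_jump.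
apply/seteqP; split=> [w [k kG kw]|w].
  have prodP A s : production (GR R) A s -> interp val alpha s `<=` val A.
    case=> [i|i j [_ ji]|]; rewrite /interp /= ?lang_cats1 ?val_max //.
  have := interp_derive _ _ _ prodP _ _ kG w.
  rewrite /interp /= lang_cats1 -map_comp; exact.
suff derives p : val p w -> exists2 k,
    clos_refl_trans _ (derive1 (GR R)) [:: inl p] [seq inr i | i <- k] &
    foldr lang_cat lang_eps [seq alpha i | i <- k] w.
  by case/derives=> k kp kw; exists k.
elim: w p => [|a w IHw] p pw.
  exists [::] => //; apply: rt_trans (jump _ ord_max _) _.
    by rewrite val_max => _ ->.
  by apply: derive_production; apply: GR_end.
have [i [ai ip /IHw[k ki kw]]] := read _ _ _ pw.
exists (i :: k) => /=; last by exists [:: a] => //; exists w.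
apply: rt_trans (jump _ _ ip) _; apply: rt_trans (derive_production _ _ _ _) _.
  exact: GR_letter.
exact: (derive_cat _ [:: inr i]).
Qed.

Theorem proposition11 (Sigma : finType) (L : set (seq Sigma)) :
  regular L ->
  exists (n : nat) (R : set ('I_n.+1 * 'I_n.+1)) (alpha : 'I_n -> set (seq Sigma)),
    [/\ (1 <= n)%N,
        R `<=` [set p | p.1 <> p.2],
        forall i, (exists a : Sigma, alpha i = [set [:: a]]) \/ alpha i = set0
      & L = aR R alpha].
Proof.
move=> /regular_derivation_closed[I [F [i0 [<- dF]]]].
pose s := enum {: I * Sigma}.
pose n := (size s).*2.+1.
(* Positions [2k+1] and [2k+2] belong to the [k]-th pair; the last one, [n],
   falls outside of [s] and receives the default [lang_eps]. *)
pose valn q : language Sigma :=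
  if q is q'.+1 then
    if onth s q'./2 is Some (i, a) then
      if odd q' then F i else lang_cat [set [:: a]] (F i)
    else lang_eps
  else F i0.
pose alphan q : language Sigma :=
  if q is q'.+1 then
    if odd q' then set0 else
    if onth s q'./2 is Some (i, a) then [set [:: a]] else set0
  else set0.
pose val (q : 'I_n.+1) := valn q.
pose alpha (q : 'I_n) := alphan q.
exists n, (inclusion_jumps val), alpha; split=> //; first by move=> p [].
  rewrite /alpha => -[[|q] _] /=; first by right.
  by case: odd; [right|case: onth => [[_ a]|]; [left; exists a|right]].
rewrite aR_inclusion_jumps //.
(* A step carrying [set0] has an empty product; inside a pair both sides are the same language. *)
- rewrite /alpha /val => q; rewrite [nat_of_ord (lift _ _)]/= /bump add1n /=.
  case: (nat_of_ord q) => [|q'] /=; first by move=> w [u []].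
  case: (boolP (odd q')) => [_ w [u []]|evenq /=].
  rewrite uphalf_half (negbTE evenq) add0n.
  by case: onth => [[i a]|] /=; [exact: subset_refl|move=> w [u []]].
- rewrite /val /= doubleK; case E: onth => [[i a]|//].
  have : (size s < size s)%N by rewrite -onthTE E.
  by rewrite ltnn.
(* With [k] the index of [(i, a)] in [s], the witness is position [2k+1]: its step reads [a] and
   lands on [F i]. *)
- have read_pair (p : 'I_n.+1) i a v : F i v -> lang_cat [set [:: a]] (F i) `<=` val p ->
      exists q : 'I_n, [/\ alpha q [:: a],
        val (widen_ord (leqnSn n) q) `<=` val p & val (lift ord0 q) v].
    move=> Fv sub; have ks : (index (i, a) s < size s)%N by rewrite index_mem mem_enum.
    have kn : ((index (i, a) s).*2.+1 < n)%N by rewrite ltnS ltn_double.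
    have sk : onth s (index (i, a) s) = Some (i, a).
      by rewrite onthE (nth_map (i, a)) // nth_index // mem_enum.
    exists (Ordinal kn); rewrite /alpha /val /bump /= odd_double doubleK sk.
    by rewrite uphalf_double sk.
  have read_state (p : 'I_n.+1) i a v : val p = F i -> F i (a :: v) ->
      exists q : 'I_n, [/\ alpha q [:: a],
        val (widen_ord (leqnSn n) q) `<=` val p & val (lift ord0 q) v].
    move=> pE /dF[j Fv Fj]; apply: (read_pair p j) => // _ [_ -> [w Fw <-]].
    by rewrite pE; apply: Fj.
  case=> -[|q] qn a v pav; first exact: (read_state _ i0).
  have pE : val (Ordinal qn) = valn q.+1 by [].
  move: pav pE; rewrite {1}/val /=; case: onth => [[i b]|] //.
  case: ifP => _ iav pE; first exact: (read_state _ i).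
  (* At the left end of a pair, the letter read is the pair's own [b] and the rest lies in [F i], so
     no derivative is taken. *)
  case: iav => _ -> [w Fw [ba <-]].
  by apply: (read_pair _ i) => //; rewrite pE ba.
Qed.
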